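(* Let $\mathbb{I}=(I,\le,\mathcal{I})$ be a set of indices, let $a\in A\in\mathcal{I}$, and let $(x_\varepsilon),(y_\varepsilon),(z_\varepsilon)\in\mathbb{R}^I$ be nets of real numbers. Then, as $\varepsilon\in\mathbb{I}$: (i) $x_\varepsilon=O_{a,A}(x_\varepsilon)$; (ii) if $x_\varepsilon=O_{a,A}(y_\varepsilon)$ and $y_\varepsilon=O_{a,A}(z_\varepsilon)$, then $x_\varepsilon=O_{a,A}(z_\varepsilon)$; (iii) $O_{a,A}(x_\varepsilon)\cdot O_{a,A}(y_\varepsilon)=O_{a,A}(x_\varepsilon\cdot y_\varepsilon)$; (iv) $O_{a,A}(x_\varepsilon)+O_{a,A}(y_\varepsilon)=O_{a,A}(|x_\varepsilon|+|y_\varepsilon|)$; (v) $x_\varepsilon\cdot O_{a,A}(y_\varepsilon)=O_{a,A}(x_\varepsilon\cdot y_\varepsilon)$; (vi) $O_{a,A}(x_\varepsilon)+O_{a,A}(x_\varepsilon)=O_{a,A}(x_\varepsilon)$; (vii) if $x_\varepsilon,y_\varepsilon\ge 0$ for all $\varepsilon\in I$, then $x_\varepsilon+O_{a,A}(y_\varepsilon)=O_{a,A}(x_\varepsilon+y_\varepsilon)$; (viii) for all $k\in\mathbb{R}$: $O_{a,A}(k\cdot x_\varepsilon)=O_{a,A}(x_\varepsilon)$; (ix) for all $k\in\mathbb{R}$: $k\cdot O_{a,A}(x_\varepsilon)=O_{a,A}(x_\varepsilon)$; (x) if $x_\varepsilon=O_{a,A}(y_\varepsilon)$ and $a\in B\subseteq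 A$ with $B\in\mathcal{I}$, then $x_\varepsilon=O_{a,B}(y_\varepsilon)$.
   Context: A set of indices is a triple $\mathbb{I}=(I,\le,\mathcal{I})$ such that: (1) $I$ is a nonempty set and $\le$ is a reflexive and transitive relation on $I$; (2) $\mathcal{I}$ is a set of subsets of $I$ with $\emptyset\notin\mathcal{I}$ and $I\in\mathcal{I}$; (3) for all $A,B\in\mathcal{I}$ there is $C\in\mathcal{I}$ with $C\subseteq A\cap B$; (4) writing $(\emptyset,e]:=\{\varepsilon\in I\mid\varepsilon\le e\}$, $A_{\le e}:=(\emptyset,e]\cap A$, and $\varepsilon<e$ for ''$\varepsilon\le e$ and $\varepsilon\neq e$'': whenever $e\le a\in A\in\mathcal{I}$, the set $A_{\le e}$ is nonempty and for all $b,c\in A_{\le e}$ there is $d\in A_{\le e}$ with $d<b$ and $d<c$. (It is not required that $e\in A$.) For $a\in A\in\mathcal{I}$ and nets $(x_\varepsilon),(y_\varepsilon)\in\mathbb{R}^I$, one writes $x_\varepsilon=O_{a,A}(y_\varepsilon)$ as $\varepsilon\in\mathbb{I}$ if there exist $H\in\mathbb{R}_{>0}$ and $\varepsilon_0\in A_{\le a}$ such that $|x_\varepsilon|\le H\cdot|y_\varepsilon|$ for all $\varepsilon\in A_{\le\varepsilon_0}$. Equalities between big-O expressions are read from left to right: e.g. (iii) means that if $x'_\varepsilon=O_{a,A}(x_\varepsilon)$ and $y'_\varepsilon=O_{a,A}(y_\varepsilon)$ then $x'_\varepsilon y'_\varepsilon=O_{a,A}(x_\varepsilon y_\varepsilon)$;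 (viii) means that $x'_\varepsilon=O_{a,A}(kx_\varepsilon)$ implies $x'_\varepsilon=O_{a,A}(x_\varepsilon)$; (ix) means that $x'_\varepsilon=O_{a,A}(x_\varepsilon)$ implies $kx'_\varepsilon=O_{a,A}(x_\varepsilon)$; and similarly for the others. *)

(* Defs.v *)
From mathcomp Require Import all_boot all_order all_algebra.
From mathcomp Require Import boolp classical_sets reals.

Set Implicit Arguments.
Unset Strict Implicit.
Unset Printing Implicit Defensive.

Import Order.TTheory GRing.Theory Num.Theory.
Local Open Scope classical_set_scope.
Local Open Scope ring_scope.

(* $(\emptyset, e]$ *)
Definition down (I : Type) (le : I -> I -> Prop) (e : I) : set I :=
  [set eps | le eps e].

(* $A_{\le e} = (\emptyset, e] \cap A$; $e$ itself need not belong to $A$. *)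
Definition trunc (I : Type) (le : I -> I -> Prop) (A : set I) (e : I) : set I :=
  down le e `&` A.

(* The order is only a preorder, and "strictly below" means below and
   different; this is not the strict part of a preorder in the sense of
   MathComp's [preorderType], where x < y means that y <= x fails. *)
Definition strict (I : Type) (le : I -> I -> Prop) (x y : I) : Prop :=
  le x y /\ x <> y.

Record indices : Type := Indices {
  icarrier :> Type;
  ile : icarrier -> icarrier -> Prop;
  ifam : set (set icarrier);
  icarrier_nonempty : exists i : icarrier, True;
  ile_refl : forall e, ile e e;
  ile_trans : forall e f g, ile e f -> ile f g -> ile e g;
  ifam_not_set0 : ~ ifam set0;
  ifam_setT : ifam setT;
  ifam_setI : forall A B, ifam A -> ifam B ->
    exists2 C, ifam C & C `<=` A `&` B;
  ifam_trunc_neq0 : forall A a e, ifam A -> A a -> ile e a ->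
    trunc ile A e !=set0;
  ifam_trunc_directed : forall A a e, ifam A -> A a -> ile e a ->
    forall b c, trunc ile A e b -> trunc ile A e c ->
    exists2 d, trunc ile A e d & strict ile d b /\ strict ile d c
}.

(* $x_\varepsilon = O_{a,A}(y_\varepsilon)$; meaningful when $a \in A \in \mathcal{I}$. *)
Definition bigO_at (II : indices) (R : realType) (a : II) (A : set II)
    (x y : II -> R) : Prop :=
  exists2 H : R, 0 < H &
  exists2 eps0 : II, trunc (@ile II) A a eps0 &
  forall eps, trunc (@ile II) A eps0 eps -> `|x eps| <= H * `|y eps|.

(* Main.v *)
Require Import Defs.
From mathcomp Require Import all_boot all_order all_algebra.
From mathcomp Require Import boolp classical_sets reals.

Set Implicit Arguments.
Unset Strict Implicit.
Unset Printing Implicit Defensive.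

Import Order.TTheory GRing.Theory Num.Theory.
Local Open Scope classical_set_scope.
Local Open Scope ring_scope.

(** The sets [trunc A eps0], with [eps0] ranging over [trunc A a], form a filter
base: any two of them contain a third, because [trunc A a] is directed
downwards and [ile] is transitive.  Two big-O hypotheses therefore hold at once
on a common tail, and two operations on bounds give everything else: the
combination of two pointwise bounds ([bigO_at_comb]), which yields transitivity,
products and sums, and the fact that a bound valid at every index is a big-O
([bigO_at_le]).  For instance, the rules with a constant [k] follow by
transitivity from [k * x = O(x)], where the positive constant [`|k| + 1] is a
bound even when [k = 0].

Passing from [A] to a smaller [B] needs the nonemptiness axiom instead: the
threshold [eps0] is in [A] but perhaps not in [B], so it is replaced by an
element of [B] below it, which exists since [eps0] lies below [a] and [a] is in
[B]. *)

Section BigOAt.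
Variables (R : realType) (II : indices).
Implicit Types (A B : set II) (a : II) (x y z : II -> R).

Lemma trunc_subset A B (e f : II) : ile e f -> A `<=` B ->
  trunc (@ile II) A e `<=` trunc (@ile II) B f.
Proof.
move=> le_ef sAB d [le_de Ad]; split; last exact: sAB.
exact: ile_trans le_de le_ef.
Qed.

(** Tails form a filter base: any two contain a third. *)
Lemma trunc_common_tail A a (b c : II) : ifam A -> A a ->
  trunc (@ile II) A a b -> trunc (@ile II) A a c ->
  exists2 d, trunc (@ile II) A a d &
    trunc (@ile II) A d `<=` trunc (@ile II) A b `&` trunc (@ile II) A c.
Proof.
move=> fA Aa Ab Ac.
have [d Ad [[le_db _] [le_dc _]]] := ifam_trunc_directed fA Aa (ile_refl a) Ab Ac.
by exists d => // e Ae; split; apply: trunc_subset Ae.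
Qed.

Lemma bigO_at_le A a (H : R) x y : A a -> 0 < H ->
  (forall e, `|x e| <= H * `|y e|) -> bigO_at a A x y.
Proof.
move=> Aa H0 le_xy; exists H => //; exists a => [|e _]; last exact: le_xy.
by split => //; exact: ile_refl.
Qed.

(** Two big-O bounds may be combined pointwise, provided that the resulting
constant depends only on the two given constants. *)
Lemma bigO_at_comb A a x1 y1 x2 y2 x3 y3 : ifam A -> A a ->
  (forall H K : R, 0 < H -> 0 < K -> exists2 L : R, 0 < L &
     forall e, `|x1 e| <= H * `|y1 e| -> `|x2 e| <= K * `|y2 e| ->
       `|x3 e| <= L * `|y3 e|) ->
  bigO_at a A x1 y1 -> bigO_at a A x2 y2 -> bigO_at a A x3 y3.
Proof.
move=> fA Aa comb [H H0 [b Ab le1]] [K K0 [c Ac le2]].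
have [L L0 le3] := comb H K H0 K0.
have [d Ad sd] := trunc_common_tail fA Aa Ab Ac.
exists L => //; exists d => // e /sd[be ce].
by apply: le3; [exact: le1 | exact: le2].
Qed.

Lemma bigO_at_refl A a x : A a -> bigO_at a A x x.
Proof. by move=> Aa; apply: (bigO_at_le Aa ltr01) => e; rewrite mul1r. Qed.

Lemma bigO_at_trans A a x y z : ifam A -> A a ->
  bigO_at a A x y -> bigO_at a A y z -> bigO_at a A x z.
Proof.
move=> fA Aa; apply: bigO_at_comb => // H K H0 K0.
exists (H * K) => [|e le_xy le_yz]; first exact: mulr_gt0.
by rewrite (le_trans le_xy)// -mulrA ler_pM2l.
Qed.

Lemma bigO_atM A a x y x' y' : ifam A -> A a ->
  bigO_at a A x' x -> bigO_at a A y' y ->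
  bigO_at a A (fun e => x' e * y' e) (fun e => x e * y e).
Proof.
move=> fA Aa; apply: bigO_at_comb => // H K H0 K0.
exists (H * K) => [|e le_x le_y]; first exact: mulr_gt0.
by rewrite !normrM mulrACA ler_pM.
Qed.

Lemma bigO_atD A a x y x' y' : ifam A -> A a ->
  bigO_at a A x' x -> bigO_at a A y' y ->
  bigO_at a A (fun e => x' e + y' e) (fun e => `|x e| + `|y e|).
Proof.
move=> fA Aa; apply: bigO_at_comb => // H K H0 K0.
exists (H + K) => [|e le_x le_y]; first exact: addr_gt0.
rewrite (ger0_norm (addr_ge0 (normr_ge0 (x e)) (normr_ge0 (y e)))).
rewrite (le_trans (ler_normD _ _))// mulrDr lerD//.
- by rewrite (le_trans le_x)// ler_wpM2r// lerDl ltW.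
- by rewrite (le_trans le_y)// ler_wpM2r// lerDr ltW.
Qed.

Lemma bigO_atZ A a (k : R) x : A a -> bigO_at a A (fun e => k * x e) x.
Proof.
move=> Aa; apply: (@bigO_at_le _ _ (`|k| + 1)) => // [|e].
  by rewrite ltr_wpDl.
by rewrite normrM ler_wpM2r// lerDl.
Qed.

Lemma bigO_at_sub A B a x y : ifam B -> B a -> B `<=` A ->
  bigO_at a A x y -> bigO_at a B x y.
Proof.
move=> fB Ba sBA [H H0 [b [le_ba _] le_xy]].
have [c [le_cb Bc]] := ifam_trunc_neq0 fB Ba le_ba.
exists H => //; exists c => [|e Be]; first by split => //; exact: ile_trans le_ba.
by apply: le_xy; apply: trunc_subset Be.
Qed.

End BigOAt.

Theorem theorem10 (R : realType) (II : indices) (A : set II) (a : II)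
    (hA : ifam A) (ha : A a) (x y z : II -> R) :
  (* (i) *)
  bigO_at a A x x /\
  (* (ii) *)
  (bigO_at a A x y -> bigO_at a A y z -> bigO_at a A x z) /\
  (* (iii) *)
  (forall x' y' : II -> R, bigO_at a A x' x -> bigO_at a A y' y ->
    bigO_at a A (fun e => x' e * y' e) (fun e => x e * y e)) /\
  (* (iv) *)
  (forall x' y' : II -> R, bigO_at a A x' x -> bigO_at a A y' y ->
    bigO_at a A (fun e => x' e + y' e) (fun e => `|x e| + `|y e|)) /\
  (* (v) *)
  (forall y' : II -> R, bigO_at a A y' y ->
    bigO_at a A (fun e => x e * y' e) (fun e => x e * y e)) /\
  (* (vi) *)
  (forall x' x'' : II -> R, bigO_at a A x' x -> bigO_at a A x'' x ->
    bigO_at a A (fun e => x' e + x'' e) x) /\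
  (* (vii) *)
  ((forall e, 0 <= x e /\ 0 <= y e) ->
    forall y' : II -> R, bigO_at a A y' y ->
    bigO_at a A (fun e => x e + y' e) (fun e => x e + y e)) /\
  (* (viii) *)
  (forall (k : R) (x' : II -> R), bigO_at a A x' (fun e => k * x e) ->
    bigO_at a A x' x) /\
  (* (ix) *)
  (forall (k : R) (x' : II -> R), bigO_at a A x' x ->
    bigO_at a A (fun e => k * x' e) x) /\
  (* (x) *)
  (forall B : set II, bigO_at a A x y -> B a -> B `<=` A -> ifam B ->
    bigO_at a B x y).
Proof.
have bigOxx := bigO_at_refl x ha.
split; first exact: bigOxx.
split; first exact: bigO_at_trans.
split; first by move=> x' y'; exact: bigO_atM.
split; first by move=> x' y'; exact: bigO_atD.
split; first by move=> y'; exact: bigO_atM.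
split.
  move=> x' x'' Ox' Ox''; apply: (bigO_at_trans hA ha (bigO_atD hA ha Ox' Ox'')).
  apply: (bigO_at_le ha (ltr0Sn R 1)) => e.
  by rewrite -mulr2n normrMn normr_id mulr_natl.
split.
  move=> xy_ge0 y' Oy'.
  apply: (bigO_at_trans hA ha (bigO_atD hA ha bigOxx Oy')).
  apply: (bigO_at_le ha ltr01) => e; have [x0 y0] := xy_ge0 e.
  by rewrite mul1r (ger0_norm x0) (ger0_norm y0).
split.
  by move=> k x' Ox'; apply: (bigO_at_trans hA ha Ox'); exact: bigO_atZ.
split.
  by move=> k x' Ox'; apply: (bigO_at_trans hA ha _ Ox'); exact: bigO_atZ.
by move=> B Oxy Ba sBA hB; apply: bigO_at_sub Oxy.
Qed.
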